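(* Let $\Omega=\mathcal V/\!\leftrightarrow$ and define $d_{\mathcal V}(\bar x,\bar y):=\|\bar x\,\vec{\vdash}\,\bar y\|_{\mathcal V}=d_{\mathcal V}(x,y)$ for $\bar x,\bar y\in\Omega$. Then: (1) this distance is well defined (independent of the choice of representatives $x\in\bar x$, $y\in\bar y$); (2) $\Omega$ with the corresponding metric topology is a Hausdorff space.
   Context: $\mathcal V=\bigcup_{n=1}^\infty \mathbb R^n$ (disjoint union, column vectors). $\mathbf 1_k\in\mathbb R^k$ is the all-ones vector, $\otimes$ the Kronecker product. For $x\in\mathbb R^m$, $y\in\mathbb R^n$ and $t=\mathrm{lcm}(m,n)$: $x\,\vec{+}\,y:=(x\otimes \mathbf 1_{t/m})+(y\otimes \mathbf 1_{t/n})\in\mathbb R^t$; $x\,\vec{\vdash}\,y:=x\,\vec{+}\,(-y)$; $\langle x,y\rangle_{\mathcal V}:=\frac1t\langle x\otimes \mathbf 1_{t/m},\,y\otimes \mathbf 1_{t/n}\rangle$; $\|x\|_{\mathcal V}:=\sqrt{\langle x,x\rangle_{\mathcal V}}$; $d_{\mathcal V}(x,y):=\|x\,\vec{\vdash}\,y\|_{\mathcal V}$. $x\leftrightarrow y$ means there exist positive integers $\alpha,\beta$ with $x\otimes \mathbf 1_\alpha=y\otimes \mathbf 1_\beta$; this is an equivalence relation on $\mathcal V$, and $\bar x$ denotes the class of $x$. On $\Omega$: $\bar x\,\vec{\vdash}\,\bar y:=\overline{x\,\vec{\vdash}\,y}$ and $\|\bar x\|_{\mathcal V}:=\|x\|_{\mathcal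 V}$. *)

(* Defs.v *)
From HB Require Import structures.
From mathcomp Require Import all_boot all_order all_algebra generic_quotient.
From mathcomp Require character.
From mathcomp Require Import all_classical reals topology.

Set Implicit Arguments.
Unset Strict Implicit.
Unset Printing Implicit Defensive.

Import Order.TTheory GRing.Theory Num.Theory.

Local Open Scope classical_set_scope.
Local Open Scope ring_scope.

Section VectorsOfAllDimensions.
Variable R : realType.

Definition posdim := {n : nat | (0 < n)%N}.

(* The disjoint union of the R^n for n >= 1; equality in vecs includes
   equality of dimensions. *)
Definition vecs := {n : posdim & 'cV[R]_(sval n)}.

Definition dim (x : vecs) : nat := sval (tag x).

Lemma dim_gt0 x : (0 < dim x)%N.
Proof. by case: x => -[]. Qed.

Definition mkvec n (n_gt0 : (0 < n)%N) (v : 'cV[R]_n) : vecs :=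
  @Tagged posdim (exist _ n n_gt0) (fun p => 'cV[R]_(sval p)) v.

(* The Kronecker product of two columns has 1 * 1 columns, which is
   convertible to 1. *)
Definition kron1 n (v : 'cV[R]_n) (k : nat) : 'cV[R]_(n * k) :=
  character.tprod v (const_mx 1 : 'cV[R]_k).

Lemma dim_kron1_gt0 (x : vecs) k : (0 < k)%N -> (0 < dim x * k)%N.
Proof. by move=> k_gt0; rewrite muln_gt0 dim_gt0. Qed.

Definition kronV (x : vecs) (k : nat) (k_gt0 : (0 < k)%N) : vecs :=
  mkvec (dim_kron1_gt0 x k_gt0) (kron1 (tagged x) k).

Definition eqvV (x y : vecs) : Prop :=
  exists (a b : nat) (a_gt0 : (0 < a)%N) (b_gt0 : (0 < b)%N),
    kronV x a_gt0 = kronV y b_gt0.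

Definition lcmdim (x y : vecs) : nat := lcmn (dim x) (dim y).

Lemma lcmdim_gt0 x y : (0 < lcmdim x y)%N.
Proof. by rewrite lcmn_gt0 !dim_gt0. Qed.

Lemma lcmdiml x y : (dim x * (lcmdim x y %/ dim x))%N = lcmdim x y.
Proof. by rewrite mulnC divnK // dvdn_lcml. Qed.

Lemma lcmdimr x y : (dim y * (lcmdim x y %/ dim y))%N = lcmdim x y.
Proof. by rewrite mulnC divnK // dvdn_lcmr. Qed.

(* x (x) 1_(t/m) and y (x) 1_(t/n), with m, n the dimensions of x, y and
   t = lcm(m, n), cast to the common dimension t *)
Definition extl (x y : vecs) : 'cV[R]_(lcmdim x y) :=
  castmx (lcmdiml x y, erefl) (kron1 (tagged x) (lcmdim x y %/ dim x)).

Definition extr (x y : vecs) : 'cV[R]_(lcmdim x y) :=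
  castmx (lcmdimr x y, erefl) (kron1 (tagged y) (lcmdim x y %/ dim y)).

Definition addV (x y : vecs) : vecs :=
  mkvec (lcmdim_gt0 x y) (extl x y + extr x y).

Definition oppV (x : vecs) : vecs := mkvec (dim_gt0 x) (- tagged x).

Definition subV (x y : vecs) : vecs := addV x (oppV y).

Definition innerV (x y : vecs) : R :=
  (lcmdim x y)%:R^-1 * \sum_i extl x y i 0 * extr x y i 0.

Definition normV (x : vecs) : R := Num.sqrt (innerV x x).

Definition distV (x y : vecs) : R := normV (subV x y).

(* Coordinates indexed by nat, used only to show that eqvV is an equivalence
   relation. *)
Definition coordV (x : vecs) (i : nat) : R :=
  if insub i is Some j then tagged x j 0 else 0.

Lemma coordV_ord x (i : 'I_(dim x)) : coordV x i = tagged x i 0.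
Proof. by rewrite /coordV valK. Qed.

Lemma vecsP x y : x = y <->
  dim x = dim y /\ (forall i, (i < dim x)%N -> coordV x i = coordV y i).
Proof.
split=> [->//|]; case: x => [[m m0] u]; case: y => [[n n0] v].
rewrite /dim /= => -[mn]; move: n0 v; case: n / mn => n0 v.
rewrite (bool_irrelevance n0 m0) => uv; congr existT.
apply/colP => i; have := uv i (ltn_ord i).
by rewrite /coordV /= valK.
Qed.

Lemma trowE n (A : 'rV[R]_n) m2 n2 (B : 'M[R]_(m2, n2)) i (j : 'I_n)
    (l : 'I_(n * n2)) (j2 : 'I_n2) : l = (j * n2 + j2)%N :> nat ->
  character.trow A B i l = A 0 j * B i j2.
Proof.
elim: n A j l => [|n IH] A j l; first by case: j.
move=> lE /=; rewrite mxE; case: (@splitP n2 (n * n2) l) => k lk.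
  have j0 : j = 0%N :> nat.
    case: (nat_of_ord j) lE => // j'; rewrite lk mulSn -addnA => kE.
    by have := ltn_ord k; rewrite kE ltnNge leq_addr.
  rewrite !mxE; congr (A _ _ * B _ _); apply/val_inj => //=.
  by rewrite -lk lE j0.
have [j' jE] : exists j' : 'I_n, j = rshift 1 j' :> 'I_(1 + n).
  case: (@splitP 1 n j) => [[[|//] ?] j0|j' jE]; last by exists j'; apply/val_inj.
  move: lE; rewrite lk j0 /= mul0n add0n => kE.
  by have := ltn_ord j2; rewrite -kE ltnNge leq_addr.
rewrite (IH _ j'); first by rewrite mxE jE.
by apply/eqP; rewrite -(eqn_add2l n2) -lk lE jE /= add1n mulSn addnA.
Qed.

Lemma kron1E n (v : 'cV[R]_n) k (i : 'I_(n * k)) (j : 'I_n) :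
  j = (i %/ k)%N :> nat -> kron1 v k i 0 = v j 0.
Proof.
rewrite /kron1; elim: n v i j => [|n IH] v i j; first by case: j.
move=> jE /=.
have k0 : (0 < k)%N by have := leq_ltn_trans (leq0n i) (ltn_ord i); rewrite muln_gt0 => /andP[].
rewrite mxE; case: (@splitP k (n * k) i) => l il.
  rewrite (@trowE 1 _ k 1 _ l 0 _ 0) // !mxE mulr1; congr (v _ _).
  by apply/val_inj; rewrite /= jE il divn_small.
have jS : j = (l %/ k).+1 :> nat by rewrite jE il divnDl ?divnn ?k0.
have lt_l : (l %/ k < n)%N by have := ltn_ord j; rewrite jS.
rewrite (IH _ _ (Ordinal lt_l)) // mxE; congr (v _ _).
by apply/val_inj; rewrite /= jS add1n.
Qed.

Lemma coord_kronV x k (k_gt0 : (0 < k)%N) i : (i < dim x * k)%N ->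
  coordV (kronV x k_gt0) i = coordV x (i %/ k).
Proof.
move=> lt_i; have lt_ik : (i %/ k < dim x)%N by rewrite ltn_divLR.
rewrite (@coordV_ord (kronV x k_gt0) (Ordinal lt_i)).
rewrite (@coordV_ord x (Ordinal lt_ik)).
exact: (@kron1E _ _ _ (Ordinal lt_i) (Ordinal lt_ik)).
Qed.

Lemma eqvVP x y : eqvV x y <-> exists a b, [/\ (0 < a)%N, (0 < b)%N,
  (dim x * a = dim y * b)%N & forall i, (i < dim x * a)%N ->
    coordV x (i %/ a) = coordV y (i %/ b)].
Proof.
split=> [[a [b [a0 [b0 /vecsP[/= dE cE]]]]]|[a [b [a0 b0 dE cE]]]].
  exists a, b; split=> // i lt_i; have := cE i lt_i.
  by rewrite !coord_kronV // -[X in (_ < X)%N]dE.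
exists a, b, a0, b0; apply/vecsP; split=> // i lt_i.
by rewrite !coord_kronV -?dE //; exact: cE.
Qed.

Lemma eqvV_refl x : eqvV x x.
Proof. by exists 1%N, 1%N, isT, isT. Qed.

Lemma eqvV_sym x y : eqvV x y -> eqvV y x.
Proof. by move=> [a [b [a0 [b0 xy]]]]; exists b, a, b0, a0. Qed.

Lemma eqvV_trans y x z : eqvV x y -> eqvV y z -> eqvV x z.
Proof.
move=> /eqvVP[a [b [a0 b0 dxy xy]]] /eqvVP[c [d [c0 d0 dyz yz]]].
apply/eqvVP; exists (a * c)%N, (b * d)%N.
have dxz : (dim x * (a * c) = dim y * c * b)%N by rewrite mulnA dxy mulnAC.
split; rewrite ?muln_gt0 ?a0 ?b0 ?c0 ?d0 //.
  by rewrite dxz dyz mulnAC mulnA.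
move=> i lt_i.
rewrite mulnC divnMA xy; last by rewrite ltn_divLR // -mulnA.
by rewrite -divnMA mulnC divnMA yz ?divnMA // ltn_divLR // -dxz.
Qed.

(* Boolean version, as required by the quotient construction *)
Definition eqvVb (x y : vecs) : bool := `[< eqvV x y >].

Lemma eqvVb_refl : reflexive eqvVb.
Proof. by move=> x; apply/asboolP/eqvV_refl. Qed.

Lemma eqvVb_sym : symmetric eqvVb.
Proof. by move=> x y; apply/asboolP/asboolP; exact: eqvV_sym. Qed.

Lemma eqvVb_trans : transitive eqvVb.
Proof.
by move=> y x z /asboolP xy /asboolP yz; apply/asboolP/(eqvV_trans xy).
Qed.

Canonical eqvV_equiv := EquivRel eqvVb eqvVb_refl eqvVb_sym eqvVb_trans.

Definition Omega : Type := {eq_quot eqvV_equiv}%qT.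

HB.instance Definition _ := Choice.on Omega.
HB.instance Definition _ := EqQuotient.on Omega.

(* The operations on classes are defined through representatives chosen by
   repr; that they do not depend on this choice has to be proved. *)
Definition subO : Omega -> Omega -> Omega := lift_op2 Omega subV.

Definition normO : Omega -> R := lift_fun1 Omega normV.

Definition distO (u v : Omega) : R := normO (subO u v).

(* Metric topology: a set is open iff it contains a ball around each of its
   points. No metric axiom is needed for these sets to form a topology. *)
Definition openO (A : set Omega) : Prop :=
  forall u, A u -> exists2 e : R, 0 < e & [set v | distO u v < e] `<=` A.

Lemma openO_setT : openO setT.
Proof. by move=> u _; exists 1. Qed.

Lemma openO_setI : setI_closed openO.
Proof.
move=> A B oA oB u [/oA[e e0 eA] /oB[f f0 fB]]; exists (Num.min e f).
  by rewrite lt_min e0.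
by move=> v /=; rewrite lt_min => /andP[ve vf]; split; [exact: eA|exact: fB].
Qed.

Lemma openO_bigcup (I : Type) (f : I -> set Omega) :
  (forall i, openO (f i)) -> openO (\bigcup_i f i).
Proof.
move=> of_ u [i _ /of_[e e0 ef]]; exists e => // v /ef fv.
by exists i.
Qed.

HB.instance Definition _ :=
  isOpenTopological.Build Omega openO_setT openO_setI openO_bigcup.

End VectorsOfAllDimensions.

Definition is_metric (R : realType) (T : Type) (d : T -> T -> R) : Prop :=
  [/\ forall x y, 0 <= d x y,
      forall x y, d x y = 0 <-> x = y,
      forall x y, d x y = d y x &
      forall x y z, d x z <= d x y + d y z].

(* Main.v *)
(* For every common multiple N of their dimensions, vectors of V can be read as
   step functions with N equal steps; refining N changes neither averages nor
   pointwise relations between step functions. In this reading x <-> y is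
   equality, subV is pointwise subtraction and normV is the L2 norm. Hence distV
   is an L2 pseudometric which vanishes exactly on equivalent vectors, so it
   induces a metric on the quotient, where disjoint balls separate points. *)
From mathcomp Require Import all_boot all_order all_algebra generic_quotient.
From mathcomp Require Import all_classical reals topology.
From mathcomp Require Import ring lra.
Require Import Defs.

Set Implicit Arguments.
Unset Strict Implicit.
Unset Printing Implicit Defensive.

Import Order.TTheory GRing.Theory Num.Theory.

Local Open Scope ring_scope.
Local Open Scope quotient_scope.

(** * Cauchy-Schwarz and Minkowski inequalities for finite sums *)

Section L2.
Variables (R : rcfType) (I : finType).
Implicit Types f g : I -> R.

Lemma sum_sqr_ge0 f : 0 <= \sum_i f i ^+ 2.
Proof. by apply: sumr_ge0 => i _; exact: sqr_ge0. Qed.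

Lemma sum_sqr_eq0 f : \sum_i f i ^+ 2 = 0 -> forall i, f i = 0.
Proof.
move=> /eqP; rewrite psumr_eq0; last by move=> i _; exact: sqr_ge0.
move=> /allP f0 i; apply/eqP; rewrite -sqrf_eq0.
exact: implyP (f0 i (mem_index_enum i)) isT.
Qed.

(** With [a] and [b] the two norms, expand the nonnegative sum of the squares of [b * f i - a * g i]
    and divide by [2 * (a * b)]. If [a * b = 0], one of the functions vanishes. *)
Lemma cauchy_schwarz f g : \sum_i f i * g i <=
  Num.sqrt (\sum_i f i ^+ 2) * Num.sqrt (\sum_i g i ^+ 2).
Proof.
set a := Num.sqrt _; set b := Num.sqrt _.
have aE : a ^+ 2 = \sum_i f i ^+ 2 by rewrite sqr_sqrtr ?sum_sqr_ge0.
have bE : b ^+ 2 = \sum_i g i ^+ 2 by rewrite sqr_sqrtr ?sum_sqr_ge0.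
have a0 : 0 <= a by exact: sqrtr_ge0.
have b0 : 0 <= b by exact: sqrtr_ge0.
have [ab0|ab_neq0] := eqVneq (a * b) 0.
  rewrite ab0 big1 // => i _; move/eqP: ab0; rewrite mulf_eq0 => /orP[] /eqP z.
    by rewrite (@sum_sqr_eq0 f) ?mul0r // -aE z expr0n.
  by rewrite (@sum_sqr_eq0 g) ?mulr0 // -bE z expr0n.
have ab_gt0 : 0 < a * b by rewrite lt_neqAle eq_sym ab_neq0 mulr_ge0.
have : 0 <= \sum_i (b * f i - a * g i) ^+ 2 by exact: sum_sqr_ge0.
have -> : \sum_i (b * f i - a * g i) ^+ 2 =
    b ^+ 2 * \sum_i f i ^+ 2 + a ^+ 2 * \sum_i g i ^+ 2
    - 2 * (a * b) * \sum_i f i * g i.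
  by rewrite !mulr_sumr -big_split -sumrB; apply: eq_bigr => i _ /=; ring.
rewrite -aE -bE => h; rewrite -(ler_pM2l ab_gt0); nra.
Qed.

Lemma minkowski f g : Num.sqrt (\sum_i (f i + g i) ^+ 2) <=
  Num.sqrt (\sum_i f i ^+ 2) + Num.sqrt (\sum_i g i ^+ 2).
Proof.
set a := Num.sqrt (\sum_i f i ^+ 2); set b := Num.sqrt (\sum_i g i ^+ 2).
have ab0 : 0 <= a + b by rewrite addr_ge0 ?sqrtr_ge0.
(* Writing [a + b] as the root of its square leaves a comparison of squares, whose cross term is
   bounded by Cauchy-Schwarz. *)
rewrite -(ger0_norm ab0) -sqrtr_sqr ler_wsqrtr //.
have -> : \sum_i (f i + g i) ^+ 2 =
    \sum_i f i ^+ 2 + \sum_i g i ^+ 2 + 2 * \sum_i f i * g i.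
  by rewrite mulr_sumr -!big_split; apply: eq_bigr => i _ /=; ring.
have := cauchy_schwarz f g; rewrite -/a -/b.
have <- : a ^+ 2 = \sum_i f i ^+ 2 by rewrite sqr_sqrtr ?sum_sqr_ge0.
have <- : b ^+ 2 = \sum_i g i ^+ 2 by rewrite sqr_sqrtr ?sum_sqr_ge0.
nra.
Qed.

End L2.

(** The refined sum repeats each [F i] exactly [k] times, and this factor cancels against the
    denominator. *)
Lemma mean_refine (R : numFieldType) (F : nat -> R) N k : (0 < k)%N ->
  (N * k)%:R^-1 * \sum_(i < N * k) F (i %/ k)%N = N%:R^-1 * \sum_(i < N) F i.
Proof.
move=> k0; have -> : \sum_(i < N * k) F (i %/ k)%N = k%:R * \sum_(i < N) F i.
  rewrite -(big_mkord xpredT (fun i => F (i %/ k)%N)) -(big_mkord xpredT F).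
  elim: N => [|N IH]; first by rewrite mul0n !big_geq // mulr0.
  rewrite mulSn addnC (big_cat_nat (n := (N * k)%N)) ?leq_addr //= IH.
  rewrite big_nat_recr //= mulrDr; congr (_ + _).
  (* Shift the last block of [k] indices to start at 0; all of them have quotient [N]. *)
  rewrite -{1}[(N * k)%N]add0n big_addn addKn big_nat.
  under eq_bigr => i /andP[_ ik].
    by rewrite divnDr ?dvdn_mull // mulnK // divn_small // add0n over.
  by rewrite -big_nat sumr_const_nat subn0 mulr_natl.
have k_neq0 : k%:R != 0 :> R by rewrite pnatr_eq0 -lt0n.
by rewrite natrM invfM mulrA -mulrA -[in LHS]mulrA mulKf.
Qed.

(** * Vectors as step functions on a common refinement *)

Section StepFunctions.
Variable R : realType.
Implicit Types (x y z : vecs R) (N : nat).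

(* Value of x (x) 1_(N / dim x) at index i; only meaningful when dim x divides
   N. *)
Definition stepV x N i : R := coordV x (i %/ (N %/ dim x)).

Lemma stepV_refine x N k i : (dim x %| N)%N ->
  stepV x (N * k) i = stepV x N (i %/ k).
Proof. by move=> xN; rewrite /stepV -divn_mulAC // mulnC divnMA. Qed.

Lemma ltn_step x N i : (dim x %| N)%N -> (i < N)%N ->
  (i %/ (N %/ dim x) < dim x)%N.
Proof.
move=> xN iN; have N0 : (0 < N)%N := leq_ltn_trans (leq0n i) iN.
by rewrite ltn_divLR ?divn_gt0 ?dim_gt0 ?(dvdn_leq N0) // mulnC divnK.
Qed.

(** Any one common multiple decides equivalence: agreement on the [M] steps supplied by [eqvV]
    passes to [N] steps through the refinement [N * M]. *)
Lemma eqvV_stepP x y N : (0 < N)%N -> (dim x %| N)%N -> (dim y %| N)%N ->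
  eqvV x y <-> (forall i, (i < N)%N -> stepV x N i = stepV y N i).
Proof.
move=> N0 xN yN; split=> [/eqvVP[a [b [a0 b0 ab xy]]] i iN|xy]; last first.
  apply/eqvVP; exists (N %/ dim x)%N, (N %/ dim y)%N.
  split; rewrite ?divn_gt0 ?dim_gt0 ?(dvdn_leq N0) //.
    by rewrite ![(dim _ * _)%N]mulnC !divnK.
  by rewrite mulnC divnK //; exact: xy.
move ME : (dim x * a)%N ab xy => M ab xy.
have M0 : (0 < M)%N by rewrite -ME muln_gt0 dim_gt0.
have xM : (dim x %| M)%N by rewrite -ME dvdn_mulr.
have yM : (dim y %| M)%N by rewrite ab dvdn_mulr.
(* Step [i] out of [N] starts at index [i * M] of the refinement; grouping the latter by [N] instead
   of [M] lands on a step out of [M]. *)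
have -> : i = (i * M %/ M)%N by rewrite mulnK.
rewrite -!stepV_refine // [(N * M)%N]mulnC !stepV_refine // /stepV.
have -> : (M %/ dim x)%N = a by rewrite -ME mulKn ?dim_gt0.
have -> : (M %/ dim y)%N = b by rewrite ab mulKn ?dim_gt0.
apply: xy.
by rewrite ltn_divLR // [(M * N)%N]mulnC ltn_pmul2r.
Qed.

Lemma extlE x y i : extl x y i 0 = stepV x (lcmdim x y) i.
Proof.
have lt_i := ltn_step (dvdn_lcml (dim x) (dim y)) (ltn_ord i).
rewrite /extl castmxE (ord1 (cast_ord _ _)) /stepV.
by rewrite (@kron1E _ _ _ _ _ (Ordinal lt_i)) // -coordV_ord.
Qed.

Lemma extrE x y i : extr x y i 0 = stepV y (lcmdim x y) i.
Proof.
have lt_i := ltn_step (dvdn_lcmr (dim x) (dim y)) (ltn_ord i).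
rewrite /extr castmxE (ord1 (cast_ord _ _)) /stepV.
by rewrite (@kron1E _ _ _ _ _ (Ordinal lt_i)) // -coordV_ord.
Qed.

Lemma coord_oppV x i : (i < dim x)%N -> coordV (oppV x) i = - coordV x i.
Proof.
move=> lt_i; rewrite (@coordV_ord _ (oppV x) (Ordinal lt_i)).
by rewrite (@coordV_ord _ x (Ordinal lt_i)) mxE.
Qed.

(** [oppV y] has the dimension of [y] by conversion, so [lcmdim x y] is also the dimension of
    [subV x y]. *)
Lemma coord_subV x y i : (i < lcmdim x y)%N ->
  coordV (subV x y) i = stepV x (lcmdim x y) i - stepV y (lcmdim x y) i.
Proof.
move=> lt_i; rewrite (@coordV_ord _ (subV x y) (Ordinal lt_i)) mxE.
by rewrite extlE extrE {2}/stepV coord_oppV // ltn_step ?dvdn_lcmr.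
Qed.

Lemma step_subV x y N i : (dim x %| N)%N -> (dim y %| N)%N -> (i < N)%N ->
  stepV (subV x y) N i = stepV x N i - stepV y N i.
Proof.
move=> xN yN iN; have lN : (lcmdim x y %| N)%N by rewrite dvdn_lcm xN.
rewrite {1}/stepV coord_subV; last exact: (@ltn_step (subV x y)).
by rewrite -!stepV_refine ?dvdn_lcml ?dvdn_lcmr // mulnC divnK.
Qed.

Lemma normV_step x N : (0 < N)%N -> (dim x %| N)%N ->
  normV x = Num.sqrt (N%:R^-1 * \sum_(i < N) stepV x N i ^+ 2).
Proof.
move=> N0 xN; rewrite /normV /innerV; congr Num.sqrt.
have lN : (lcmdim x x %| N)%N by rewrite dvdn_lcm xN.
rewrite -(divnK lN) mulnC; set k := (N %/ _)%N.
have k0 : (0 < k)%N by rewrite divn_gt0 ?lcmdim_gt0 ?(dvdn_leq N0).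
under [in RHS]eq_bigr do rewrite stepV_refine ?dvdn_lcml //.
rewrite (mean_refine (fun j => stepV x (lcmdim x x) j ^+ 2)) //.
by congr (_ * _); apply: eq_bigr => i _; rewrite extlE extrE expr2.
Qed.

Lemma distV_step x y N : (0 < N)%N -> (dim x %| N)%N -> (dim y %| N)%N ->
  distV x y =
  Num.sqrt (N%:R^-1 * \sum_(i < N) (stepV x N i - stepV y N i) ^+ 2).
Proof.
move=> N0 xN yN; rewrite /distV (@normV_step _ N) //; last first.
  by rewrite dvdn_lcm xN.
by under eq_bigr do rewrite step_subV //.
Qed.

(** * Pseudometric laws for [distV] and compatibility with [eqvV] *)

Lemma distV_ge0 x y : 0 <= distV x y.
Proof. exact: sqrtr_ge0. Qed.

Lemma distV_eq0 x y : distV x y = 0 <-> eqvV x y.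
Proof.
have xN : (dim x %| lcmdim x y)%N by exact: dvdn_lcml.
have yN : (dim y %| lcmdim x y)%N by exact: dvdn_lcmr.
have N0 := lcmdim_gt0 x y.
rewrite (distV_step N0 xN yN) (eqvV_stepP N0 xN yN).
set N := lcmdim x y in N0 *; split=> [/eqP|xy]; last first.
  rewrite big1 ?mulr0 ?sqrtr0 // => i _.
  by rewrite xy // subrr expr0n.
have Nn : 0 < N%:R^-1 :> R by rewrite invr_gt0 ltr0n.
(* [Num.sqrt] is 0 on negative numbers too, so this only yields that the sum is at most 0; its
   nonnegativity is added below. *)
rewrite sqrtr_eq0 pmulr_rle0 // => s0 i iN; apply/subr0_eq.
apply: (@sum_sqr_eq0 _ _ (fun i : 'I_N => stepV x N i - stepV y N i)
  _ (Ordinal iN)).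
by apply/le_anti; rewrite s0 sum_sqr_ge0.
Qed.

Lemma distVC x y : distV x y = distV y x.
Proof.
have xN : (dim x %| lcmdim x y)%N by exact: dvdn_lcml.
have yN : (dim y %| lcmdim x y)%N by exact: dvdn_lcmr.
rewrite !(distV_step (lcmdim_gt0 x y)) //.
by under eq_bigr do rewrite -sqrrN opprB.
Qed.

Lemma distV_triangle y x z : distV x z <= distV x y + distV y z.
Proof.
pose N := (dim x * dim y * dim z)%N.
have N0 : (0 < N)%N by rewrite !muln_gt0 !dim_gt0.
have xN : (dim x %| N)%N by rewrite /N -mulnA dvdn_mulr.
have yN : (dim y %| N)%N by rewrite /N mulnAC dvdn_mull.
have zN : (dim z %| N)%N by rewrite dvdn_mull.
have Nn : 0 <= N%:R^-1 :> R by rewrite invr_ge0 ler0n.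
(* On [N] common steps, all three distances share the factor [Num.sqrt N%:R^-1]; without it
   Minkowski applies. *)
rewrite !(distV_step N0) // !sqrtrM // -mulrDr ler_wpM2l ?sqrtr_ge0 //.
under eq_bigr => i _ do rewrite -(subrKA (stepV y N i)).
exact: minkowski.
Qed.

(** Two triangle inequalities through points at distance 0 from each other. *)
Lemma distV_eqvl x x' y : eqvV x x' -> distV x y = distV x' y.
Proof.
move=> xx'; have d0 : distV x x' = 0 by apply/distV_eq0.
have := distV_triangle x' x y; have := distV_triangle x x' y.
by rewrite (distVC x' x) d0 !add0r => h1 h2; apply/le_anti; rewrite h1 h2.
Qed.

Lemma distV_eqv x x' y y' : eqvV x x' -> eqvV y y' -> distV x y = distV x' y'.
Proof.
move=> xx' yy'; rewrite (distV_eqvl _ xx') distVC (distV_eqvl _ yy').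
exact: distVC.
Qed.

Lemma normV_eqv x x' : eqvV x x' -> normV x = normV x'.
Proof.
have N0 : (0 < dim x * dim x')%N by rewrite muln_gt0 !dim_gt0.
have xN : (dim x %| dim x * dim x')%N by rewrite dvdn_mulr.
have x'N : (dim x' %| dim x * dim x')%N by rewrite dvdn_mull.
rewrite (eqvV_stepP N0 xN x'N) !(normV_step N0) // => xx'.
by under eq_bigr do rewrite xx' //.
Qed.

Lemma subV_eqv x x' y y' :
  eqvV x x' -> eqvV y y' -> eqvV (subV x y) (subV x' y').
Proof.
pose N := ((dim x * dim x') * (dim y * dim y'))%N.
have N0 : (0 < N)%N by rewrite !muln_gt0 !dim_gt0.
have xN : (dim x %| N)%N by rewrite /N -mulnA dvdn_mulr.
have x'N : (dim x' %| N)%N by rewrite /N [(dim x * _)%N]mulnC -mulnA dvdn_mulr.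
have yN : (dim y %| N)%N by rewrite dvdn_mull // dvdn_mulr.
have y'N : (dim y' %| N)%N by rewrite dvdn_mull // dvdn_mull.
rewrite (eqvV_stepP N0 xN x'N) (eqvV_stepP N0 yN y'N) => xx' yy'.
apply/(eqvV_stepP N0); try by rewrite dvdn_lcm ?xN ?x'N.
by move=> i iN; rewrite !step_subV // xx' ?yy'.
Qed.

End StepFunctions.

(** * The metric on the quotient and its topology *)

Section Quotient.
Variable R : realType.
Implicit Types (x y : vecs R) (u v w : Omega R).

Lemma piO_eqP x y : \pi_(Omega R) x = \pi_(Omega R) y <-> eqvV x y.
Proof. by split=> [/eqmodP/asboolP|xy]; last exact/eqmodP/asboolP. Qed.

Lemma repr_piO x : eqvV (repr (\pi_(Omega R) x)) x.
Proof. by apply/piO_eqP; rewrite reprK. Qed.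

Lemma subO_pi x y :
  subO (\pi_(Omega R) x) (\pi_(Omega R) y) = \pi_(Omega R) (subV x y).
(* Unlocking the lift exposes [subV] at the representatives chosen by [repr], which are equivalent
   to [x] and [y]. *)
Proof. by rewrite /subO -lock; apply/piO_eqP/subV_eqv; exact: repr_piO. Qed.

Lemma normO_pi x : normO (\pi_(Omega R) x) = normV x.
Proof. by rewrite /normO -lock; apply/normV_eqv/repr_piO. Qed.

Lemma distO_pi x y : distO (\pi_(Omega R) x) (\pi_(Omega R) y) = distV x y.
Proof. by rewrite /distO subO_pi normO_pi. Qed.

(** Carries the laws of [distV] over to classes. *)
Lemma distOE u v : distO u v = distV (repr u) (repr v).
Proof. by rewrite -distO_pi !reprK. Qed.

Lemma distO_metric : is_metric (@distO R).
Proof.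
split=> [u v|u v|u v|u v w]; rewrite !distOE; first exact: distV_ge0.
- by rewrite distV_eq0 -piO_eqP !reprK.
- exact: distVC.
- exact: distV_triangle.
Qed.

Lemma open_ballO u (e : R) : open [set v | distO u v < e]%classic.
Proof.
have [_ _ _ tri] := distO_metric.
move=> v /= uv; exists (e - distO u v); first by rewrite subr_gt0.
by move=> w /= vw; have := tri u v w; lra.
Qed.

Lemma hausdorffO : hausdorff_space (Omega R).
Proof.
have [d_ge0 d_eq0 dC tri] := distO_metric.
rewrite open_hausdorff => u v uv.
have d0 : 0 < distO u v.
  by rewrite lt_neqAle d_ge0 andbT eq_sym; apply: contra uv => /eqP/d_eq0 ->.
have duu w : distO w w = 0 by apply/d_eq0.
(* Balls of half the distance: by the triangle inequality, a common point [w] would give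
   [distO u v < distO u v]. *)
exists ([set w | distO u w < distO u v / 2],
        [set w | distO v w < distO u v / 2])%classic => /=.
  by split; rewrite inE /= duu divr_gt0.
split; try exact: open_ballO.
apply/eqP/seteqP; split=> // w /= [uw vw].
by have := tri u w v; rewrite (dC w v); lra.
Qed.

End Quotient.

Theorem mainTheorem6 (R : realType) :
  [/\ forall x x' y y' : vecs R,
        eqvV x x' -> eqvV y y' -> distV x y = distV x' y',
      forall x y : vecs R,
        subO (\pi_(Omega R) x) (\pi_(Omega R) y) = \pi_(Omega R) (subV x y),
      forall x : vecs R, normO (\pi_(Omega R) x) = normV x &
      forall x y : vecs R,
        distO (\pi_(Omega R) x) (\pi_(Omega R) y) = distV x y]
  /\ (is_metric (@distO R) /\ hausdorff_space (Omega R)).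
Proof.
split; last by split; [exact: distO_metric | exact: hausdorffO].
split; [exact: distV_eqv | exact: subO_pi | exact: normO_pi | exact: distO_pi].
Qed.
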